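(* Let $\alpha>1$, $r=\frac12(1-\frac1\alpha)$, let $s\ge2$ be an integer, and define $\overline a=\frac{s-1}{2}$ if $s$ is odd and $\overline a=\frac s2$ if $s$ is even, $\overline b=s-\overline a$, and $n''_*=\lfloor-\log_r\overline a\rfloor+1$. Let $k$ be a positive even integer and $a_1,\dots,a_k$ positive integers with $a_{2i-1}+a_{2i}=s$ for $i=1,\dots,k/2$. If \[ k\ \ge\ \max\Bigg\{\left\lceil 2\,\frac{(1-r+r^{n''_*})^{\overline a-1}\,[\,\overline b(1-r+r^{n''_*})+\overline a\,]}{(1-r)^{\overline a-1}(1-r^{n''_*})^{\overline b-1}\,[\,\overline b(1-r)+\overline a(1-r^{n''_*})\,]}+2\right\rceil\cdot\Big(\frac{1-r}{r}\Big)^{\overline a},\ \ 2\Big(\frac{1-r}{r}\Big)^{\overline a+1},\ \ 2\Big(\frac1{1-r}\Big)^{s-1}+2\Bigg\}, \] then \[ \Big[0,\tfrac k2\Big]=\Big\{\sum_{i=1}^{k/2}x_{2i-1}^{a_{2i-1}}x_{2i}^{a_{2i}}:\ x_1,\dots,x_k\in C_\alpha\Big\}. \]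
   Context: For real $\alpha>1$ let $r=\frac12(1-\frac1\alpha)\in(0,\frac12)$. Define $f_0,f_1:[0,1]\to[0,1]$ by $f_0(x)=rx$, $f_1(x)=rx+1-r$; for $\omega=\sigma_1\cdots\sigma_n\in\{0,1\}^n$ let $f_\omega=f_{\sigma_1}\circ\cdots\circ f_{\sigma_n}$. Let $F_n=\{f_\omega([0,1]):\omega\in\{0,1\}^n\}$ (the level-$n$ basic intervals, each of length $r^n$), $C_n=\bigcup_{I\in F_n}I$, and $C_\alpha=\bigcap_{n\ge1}C_n$ (the middle-$\frac1\alpha$ Cantor set; $C_3$ is the ternary Cantor set). *)

(* Defs.v *)
From Stdlib Require Import Reals Lra Lia List.
Open Scope R_scope.

Definition ratio (alpha : R) : R := (1 - 1 / alpha) / 2.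

Definition f0 (alpha x : R) : R := ratio alpha * x.
Definition f1 (alpha x : R) : R := ratio alpha * x + 1 - ratio alpha.
Definition fsig (alpha : R) (b : bool) : R -> R := if b then f1 alpha else f0 alpha.

Fixpoint fword (alpha : R) (w : list bool) (x : R) : R :=
  match w with
  | nil => x
  | b :: w' => fsig alpha b (fword alpha w' x)
  end.

Definition Cn (alpha : R) (n : nat) (y : R) : Prop :=
  exists w : list bool, length w = n /\ exists t, 0 <= t <= 1 /\ y = fword alpha w t.

(* the middle-1/alpha Cantor set *)
Definition Calpha (alpha : R) (y : R) : Prop := forall n : nat, (1 <= n)%nat -> Cn alpha n y.

Definition Rfloor (x : R) : Z := (up x - 1)%Z.
Definition Rceil (x : R) : Z := (- Rfloor (- x))%Z.

Definition abar (s : nat) : nat := if Nat.odd s then ((s - 1) / 2)%nat else (s / 2)%nat.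
Definition bbar (s : nat) : nat := (s - abar s)%nat.

Definition logb (b x : R) : R := ln x / ln b.

(* n''_* = floor(-log_r abar) + 1  (an integer >= 1 here) *)
Definition nstar (alpha : R) (s : nat) : nat :=
  Z.to_nat (Rfloor (- logb (ratio alpha) (INR (abar s))) + 1).

Definition bigQ (alpha : R) (s : nat) : R :=
  let r := ratio alpha in
  let n := nstar alpha s in
  let a := abar s in
  let b := bbar s in
  ((1 - r + r ^ n) ^ (a - 1) * (INR b * (1 - r + r ^ n) + INR a))
  / ((1 - r) ^ (a - 1) * (1 - r ^ n) ^ (b - 1) * (INR b * (1 - r) + INR a * (1 - r ^ n))).

Definition kbound (alpha : R) (s : nat) : R :=
  let r := ratio alpha in
  Rmax (Rmax (IZR (Rceil (2 * bigQ alpha s + 2)) * ((1 - r) / r) ^ (abar s))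
             (2 * ((1 - r) / r) ^ (abar s + 1)))
       (2 * (1 / (1 - r)) ^ (s - 1) + 2).

Definition sum1 (m : nat) (F : nat -> R) : R := fold_right Rplus 0 (map F (seq 1 m)).

(* Main.v *)
Require Import Defs.
From Stdlib Require Import Reals List.
From Stdlib Require Import Arith Lra Lia Classical IndefiniteDescription.
Open Scope R_scope.

(** In each pair set the variable with the larger exponent to 1: it suffices to
    represent every point of [[0, m]], [m = k/2], as a sum of [m] powers
    [x_i ^ e_i] with [x_i] in the Cantor set and [e_i <= A = abar s].
    Write [rho = (1-r)/r] and [K = rho^A - 1]. Because
    [(z + rho h)^e - z^e <= rho^e ((z + h)^e - z^e)], each gap of the set of [e]-th
    powers is at most [K] times either of its bridges, that is, this set has
    Newhouse thickness at least [1/K]. The second term of the bound on [k] gives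
    [m - 1 >= K], so cutting the largest gap of the finite-level sets first never
    loses the target point; compactness passes to the Cantor set. *)

(** * Cells with finitely many gaps, and thickness *)

Definition Rsum (l : list R) : R := fold_right Rplus 0 l.

Lemma Rsum_app (l1 l2 : list R) : Rsum (l1 ++ l2) = Rsum l1 + Rsum l2.
Proof. induction l1 as [|x l1 IH]; simpl; [ring | rewrite IH; ring]. Qed.

Definition gap_size (g : R * R) : R := snd g - fst g.

(** A gap is the pair of endpoints of an open interval removed from [[lo, hi]]. The list of gaps is
    unordered, so [thick] compares gaps pairwise. *)
Record cell := Cell { lo : R; hi : R; gaps : list (R * R) }.

Definition survives (c : cell) (t : R) : Prop :=
  lo c <= t <= hi c /\ forall g, In g (gaps c) -> t <= fst g \/ snd g <= t.

(* Newhouse thickness at least [1/K]. *)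
Definition thick (K : R) (c : cell) : Prop :=
  lo c <= hi c /\
  (forall g, In g (gaps c) ->
     fst g < snd g /\ gap_size g <= K * (fst g - lo c) /\
     gap_size g <= K * (hi c - snd g)) /\
  (forall g g', In g (gaps c) -> In g' (gaps c) ->
     g = g' \/
     Rmin (gap_size g) (gap_size g') <= K * (fst g' - snd g) \/
     Rmin (gap_size g) (gap_size g') <= K * (fst g - snd g')).

Definition gap_left (u : R) (g : R * R) : bool := if Rle_dec (snd g) u then true else false.
Definition gap_right (v : R) (g : R * R) : bool := if Rle_dec v (fst g) then true else false.

(** Applied with [u] the left endpoint of the largest gap: the filter then drops that gap and every
    gap beyond it. *)
Definition cut_left (c : cell) (u : R) : cell := Cell (lo c) u (filter (gap_left u) (gaps c)).
Definition cut_right (c : cell) (v : R) : cell := Cell v (hi c) (filter (gap_right v) (gaps c)).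

Lemma in_gap_left u g l : In g (filter (gap_left u) l) <-> In g l /\ snd g <= u.
Proof.
  rewrite filter_In. unfold gap_left. destruct (Rle_dec (snd g) u); intuition; discriminate.
Qed.

Lemma in_gap_right v g l : In g (filter (gap_right v) l) <-> In g l /\ v <= fst g.
Proof.
  rewrite filter_In. unfold gap_right. destruct (Rle_dec v (fst g)); intuition; discriminate.
Qed.

Lemma filter_length_lt {A} (f : A -> bool) l x :
  In x l -> f x = false -> (length (filter f l) < length l)%nat.
Proof.
  induction l as [|a l IH]; simpl; [tauto|].
  pose proof (filter_length_le f l) as H.
  intros [->|Hx] Hf.
  - rewrite Hf. lia.
  - specialize (IH Hx Hf). destruct (f a); simpl; lia.
Qed.

(** * Cutting a cell at its largest gap *)

Section CutLargest.
Variables (K : R) (c : cell) (g0 : R * R).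
Hypotheses (K_pos : 0 < K) (c_thick : thick K c) (g0_in : In g0 (gaps c))
  (g0_max : forall g, In g (gaps c) -> gap_size g <= gap_size g0).

(** Since [g0] is largest, the minimum in [thick] is the size of [g]. This size is positive, so the
    bridge between [g] and [g0] has positive length and [g] lies strictly on one side. *)
Lemma gap_trichotomy g :
  In g (gaps c) ->
  g = g0 \/ (snd g < fst g0 /\ gap_size g <= K * (fst g0 - snd g)) \/
  (snd g0 < fst g /\ gap_size g <= K * (fst g - snd g0)).
Proof.
  intros Hg. destruct c_thick as (_ & H1 & H2).
  destruct (H1 g Hg) as (Hlt & _). pose proof (g0_max g Hg) as Hm.
  destruct (H2 g g0 Hg g0_in) as [E|H]; [now left|right].
  rewrite (Rmin_left _ _ Hm) in H.
  assert (0 < gap_size g) by (unfold gap_size; lra).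
  destruct H; [left|right]; split; try assumption; nra.
Qed.

(** Only the bridges up to the right end are new: they now stop at [g0], where [gap_trichotomy]
    bounds them. All other conditions are inherited from [c]. *)
Lemma thick_cut_left : thick K (cut_left c (fst g0)).
Proof.
  destruct c_thick as (H0 & H1 & H2).
  destruct (H1 g0 g0_in) as (Hlt & Hl & _).
  assert (0 < gap_size g0) by (unfold gap_size; lra).
  split; [|split]; simpl.
  - nra.
  - intros g Hg. apply in_gap_left in Hg as [Hg Hu].
    destruct (H1 g Hg) as (A & B & _). repeat split; try assumption.
    destruct (gap_trichotomy g Hg) as [->|[[_ D]|[D _]]]; [lra|exact D|lra].
  - intros g g' Hg Hg'. apply in_gap_left in Hg, Hg'. apply H2; tauto.
Qed.

Lemma thick_cut_right : thick K (cut_right c (snd g0)).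
Proof.
  destruct c_thick as (H0 & H1 & H2).
  destruct (H1 g0 g0_in) as (Hlt & _ & Hr).
  assert (0 < gap_size g0) by (unfold gap_size; lra).
  split; [|split]; simpl.
  - nra.
  - intros g Hg. apply in_gap_right in Hg as [Hg Hu].
    destruct (H1 g Hg) as (A & _ & B). repeat split; try assumption.
    destruct (gap_trichotomy g Hg) as [->|[[D _]|[_ D]]]; [lra|lra|exact D].
  - intros g g' Hg Hg'. apply in_gap_right in Hg, Hg'. apply H2; tauto.
Qed.

(** The gaps forgotten by the cut are [g0] and those to its right, and a point of the left half lies
    before all of them. *)
Lemma survives_cut_left t : survives (cut_left c (fst g0)) t -> survives c t.
Proof.
  destruct c_thick as (H0 & H1 & _). destruct (H1 g0 g0_in) as (Hlt & _ & Hr).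
  assert (0 < gap_size g0) by (unfold gap_size; lra).
  intros [Ht Hs]; simpl in *. split; [split; [lra|nra]|].
  intros g Hg. destruct (gap_trichotomy g Hg) as [->|[[D _]|[D _]]]; [lra| |lra].
  apply Hs, in_gap_left. split; [assumption|lra].
Qed.

Lemma survives_cut_right t : survives (cut_right c (snd g0)) t -> survives c t.
Proof.
  destruct c_thick as (H0 & H1 & _). destruct (H1 g0 g0_in) as (Hlt & Hl & _).
  assert (0 < gap_size g0) by (unfold gap_size; lra).
  intros [Ht Hs]; simpl in *. split; [split; [nra|lra]|].
  intros g Hg. destruct (gap_trichotomy g Hg) as [->|[[D _]|[D _]]]; [lra|lra|].
  apply Hs, in_gap_right. split; [assumption|lra].
Qed.

End CutLargest.

(** * Sums of points surviving in thick cells *)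

Lemma exists_max {A} (f : A -> R) (l : list A) :
  l <> nil -> exists x, In x l /\ forall x', In x' l -> f x' <= f x.
Proof.
  induction l as [|a l IH]; [congruence|intros _].
  destruct l as [|b l].
  - exists a. split; [now left|]. intros x' [->|[]]; lra.
  - destruct IH as (x & Hx & Hm); [discriminate|].
    destruct (Rle_dec (f a) (f x)).
    + exists x. split; [now right|]. intros x' [<-|H]; auto.
    + exists a. split; [now left|]. intros x' [<-|H]; [lra|].
      specialize (Hm x' H). lra.
Qed.

Lemma Rsum_interval (cs : list cell) (y : R) :
  (forall c, In c cs -> lo c <= hi c /\ gaps c = nil) ->
  Rsum (map lo cs) <= y <= Rsum (map hi cs) ->
  exists ts, Forall2 survives cs ts /\ Rsum ts = y.
Proof.
  revert y. induction cs as [|c cs IH]; simpl; intros y Hc Hy.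
  - exists nil. split; [constructor|simpl; lra].
  - destruct (Hc c (or_introl eq_refl)) as [Hle Hn].
    (* Greedy choice: the head takes as much as it can while leaving the other cells at least the
       sum of their left ends. *)
    set (t := Rmax (lo c) (Rmin (hi c) (y - Rsum (map lo cs)))).
    assert (Rsum (map lo cs) <= Rsum (map hi cs)) as Hcs.
    { clear - Hc. induction cs as [|d cs IH]; simpl; [lra|].
      assert (lo d <= hi d) by (apply Hc; simpl; auto).
      assert (Rsum (map lo cs) <= Rsum (map hi cs)); [|lra].
      apply IH. intros e He. apply Hc. simpl in *; tauto. }
    assert (lo c <= t <= hi c /\ Rsum (map lo cs) <= y - t <= Rsum (map hi cs)) as [Ht Hyt].
    { unfold t, Rmax, Rmin.
      destruct (Rle_dec (hi c) (y - Rsum (map lo cs)));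
      [destruct (Rle_dec (lo c) (hi c))
      |destruct (Rle_dec (lo c) (y - Rsum (map lo cs)))]; lra. }
    destruct (IH (y - t)) as (ts & Hts & Hs); [auto|assumption|].
    exists (t :: ts). split.
    + constructor; [|assumption]. split; [assumption|]. rewrite Hn. intros g [].
    + simpl. rewrite Hs. ring.
Qed.

Lemma Rsum_width_ge (w : R) (cs : list cell) :
  (forall c, In c cs -> w <= hi c - lo c) ->
  INR (length cs) * w <= Rsum (map hi cs) - Rsum (map lo cs).
Proof.
  induction cs as [|c cs IH]; intros H; [simpl; lra|].
  cbn [length map Rsum fold_right]. rewrite S_INR.
  assert (w <= hi c - lo c) by (apply H; now left).
  assert (INR (length cs) * w <= Rsum (map hi cs) - Rsum (map lo cs))
    by (apply IH; intros; apply H; now right).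
  unfold Rsum in *. lra.
Qed.

(* The largest remaining gap is always at most the total width of the other
   cells, so one of the two halves obtained by cutting there still works. *)
Lemma thick_sum (K : R) (cs : list cell) (y : R) :
  0 < K -> K <= INR (length cs) - 1 ->
  (forall c, In c cs -> thick K c) ->
  (forall c d g, In c cs -> In d cs -> In g (gaps c) -> gap_size g <= K * (hi d - lo d)) ->
  Rsum (map lo cs) <= y <= Rsum (map hi cs) ->
  exists ts, Forall2 survives cs ts /\ Rsum ts = y.
Proof.
  intros HK.
  (* Strong induction on the total number of gaps, which every cut lowers. *)
  remember (length (flat_map gaps cs)) as n eqn:En.
  revert cs y En. induction n as [n IH] using (well_founded_induction Nat.lt_wf_0).
  intros cs y En Hlen Hthick Hcross Hy.
  assert ({flat_map gaps cs = nil} + {flat_map gaps cs <> nil}) as [E|E]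
    by (destruct (flat_map gaps cs); [now left | now right]).
  { apply Rsum_interval; [|assumption].
    intros c Hc. split; [apply (Hthick c Hc)|].
    destruct (gaps c) as [|g l] eqn:Eg; [reflexivity|].
    assert (In g (flat_map gaps cs)) as Hg
      by (apply in_flat_map; exists c; rewrite Eg; simpl; auto).
    rewrite E in Hg. destruct Hg. }
  destruct (exists_max gap_size _ E) as (g0 & Hg0 & Hmax).
  apply in_flat_map in Hg0 as (c & Hc & Hg0).
  assert (forall d g, In d cs -> In g (gaps d) -> gap_size g <= gap_size g0) as Hmax'.
  { intros d g Hd Hg. apply Hmax, in_flat_map. eauto. }
  clear Hmax.
  pose proof (Hthick c Hc) as Tc.
  assert (forall g, In g (gaps c) -> gap_size g <= gap_size g0) as Hmc by eauto.
  apply in_split in Hc as Hsp. destruct Hsp as (l1 & l2 & ->).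
  assert (0 < gap_size g0 /\ gap_size g0 <= K * (fst g0 - lo c) /\
          gap_size g0 <= K * (hi c - snd g0) /\ fst g0 < snd g0) as (G0 & G1 & G2 & G3).
  { destruct Tc as (_ & H1 & _). destruct (H1 g0 Hg0) as (A & B & D).
    repeat split; try assumption. unfold gap_size; lra. }
  (* There are at least [K] other cells, and by the cross condition each has width at least
     [gap_size g0 / K]. *)
  assert (gap_size g0 <= Rsum (map hi (l1 ++ l2)) - Rsum (map lo (l1 ++ l2))) as Hoth.
  { apply Rle_trans with (INR (length (l1 ++ l2)) * (gap_size g0 / K)).
    - assert (K <= INR (length (l1 ++ l2))).
      { rewrite length_app in Hlen |- *. cbn [length] in Hlen.
        rewrite Nat.add_succ_r, S_INR in Hlen. lra. }
      apply Rle_trans with (K * (gap_size g0 / K)); [right; field; lra|].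
      apply Rmult_le_compat_r; [|assumption].
      apply Rlt_le, Rdiv_lt_0_compat; assumption.
    - apply Rsum_width_ge. intros d Hd.
      apply Rmult_le_reg_l with K; [assumption|].
      replace (K * (gap_size g0 / K)) with (gap_size g0) by (field; lra).
      apply (Hcross c d g0); auto.
      rewrite in_app_iff in Hd |- *; simpl; tauto. }
  (* Replacing [c] by one half [c'] keeps the cross condition: no gap exceeds [g0], and [g0] is at
     most [K] times the width of [c'] because that half is a bridge of [g0]. *)
  assert (forall c', thick K c' -> incl (gaps c') (gaps c) ->
            (length (gaps c') < length (gaps c))%nat ->
            gap_size g0 <= K * (hi c' - lo c') ->
            (forall t, survives c' t -> survives c t) ->
            Rsum (map lo (l1 ++ c' :: l2)) <= y <= Rsum (map hi (l1 ++ c' :: l2)) ->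
            exists ts, Forall2 survives (l1 ++ c :: l2) ts /\ Rsum ts = y) as Step.
  { intros c' T' I' L' W' S' Hy'.
    destruct (IH (length (flat_map gaps (l1 ++ c' :: l2)))) with (cs := l1 ++ c' :: l2) (y := y)
      as (ts & Hts & Hs); auto.
    - subst n. rewrite !flat_map_app; cbn [flat_map]. rewrite !length_app. lia.
    - rewrite length_app in *; exact Hlen.
    - intros d Hd. rewrite in_app_iff in Hd. destruct Hd as [Hd|[<-|Hd]]; auto;
      apply Hthick; rewrite in_app_iff; simpl; tauto.
    - assert (forall d g, In d (l1 ++ c' :: l2) -> In g (gaps d) ->
                exists d', In d' (l1 ++ c :: l2) /\ In g (gaps d')) as Hold.
      { intros d g Hd Hg. rewrite in_app_iff in Hd. destruct Hd as [Hd|[<-|Hd]].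
        - exists d. rewrite in_app_iff; auto.
        - exists c. auto.
        - exists d. rewrite in_app_iff; simpl; auto. }
      intros d e g Hd He Hg. destruct (Hold d g Hd Hg) as (d' & Hd' & Hg').
      rewrite in_app_iff in He. destruct He as [He|[<-|He]].
      + apply (Hcross d' e g); auto. rewrite in_app_iff; auto.
      + specialize (Hmax' d' g Hd' Hg'). lra.
      + apply (Hcross d' e g); auto. rewrite in_app_iff; simpl; auto.
    - exists ts. split; [|assumption].
      apply Forall2_app_inv_l in Hts as (t1 & t2 & A & B & ->).
      inversion B as [|? t ? t2' Ht Ht2]; subst.
      apply Forall2_app; [assumption|]. constructor; auto. }
  rewrite !map_app, !Rsum_app in Hoth.
  rewrite !map_app, !Rsum_app in Hy. cbn [map Rsum fold_right] in Hy. fold Rsum in Hy.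
  (* The threshold is the largest sum available with the left half. Above it, [y] also exceeds the
     smallest sum available with the right half, since by [Hoth] the two ranges of sums leave no
     hole. *)
  destruct (Rle_dec y (Rsum (map hi l1) + (fst g0 + Rsum (map hi l2)))) as [Hle|Hgt].
  - apply (Step (cut_left c (fst g0))).
    + apply thick_cut_left; auto.
    + intros g Hg. apply in_gap_left in Hg; tauto.
    + simpl. apply filter_length_lt with g0; [assumption|].
      unfold gap_left. destruct (Rle_dec (snd g0) (fst g0)); [lra|reflexivity].
    + exact G1.
    + intros t. apply (survives_cut_left K c g0); auto.
    + rewrite !map_app, !Rsum_app. simpl in *. unfold Rsum in *. lra.
  - apply (Step (cut_right c (snd g0))).
    + apply thick_cut_right; auto.
    + intros g Hg. apply in_gap_right in Hg; tauto.
    + simpl. apply filter_length_lt with g0; [assumption|].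
      unfold gap_right. destruct (Rle_dec (snd g0) (fst g0)); [lra|reflexivity].
    + exact G2.
    + intros t. apply (survives_cut_right K c g0); auto.
    + rewrite !map_app, !Rsum_app. simpl in *. unfold Rsum, gap_size in *. lra.
Qed.

(** * Increments of powers, Lipschitz bound and roots *)

Lemma pow_increment_nonneg (a : nat) (z h : R) :
  0 <= z -> 0 <= h -> 0 <= (z + h) ^ a - z ^ a.
Proof. intros Hz Hh. pose proof (pow_incr z (z + h) a). lra. Qed.

(** The induction step uses [z + rho * h <= rho * (z + h)] for one part of the increment and
    [1 <= rho ^ a] for the other. *)
Lemma pow_increment_scale (a : nat) (rho z h : R) :
  1 <= rho -> 0 <= z -> 0 <= h ->
  (z + rho * h) ^ a - z ^ a <= rho ^ a * ((z + h) ^ a - z ^ a).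
Proof.
  intros Hrho Hz Hh. induction a as [|a IH]; [simpl; lra|].
  pose proof (pow_increment_nonneg a z h Hz Hh) as HD.
  pose proof (pow_R1_Rle rho a Hrho) as Hp.
  pose proof (pow_le z a Hz) as Hza.
  cbn [pow]. set (D := (z + h) ^ a) in *. set (E := (z + rho * h) ^ a) in *.
  set (Z := z ^ a) in *. set (P := rho ^ a) in *.
  assert (0 <= rho * h) by nra.
  apply Rle_trans with ((z + rho * h) * (P * (D - Z)) + rho * h * Z).
  - replace ((z + rho * h) * E - z * Z) with ((z + rho * h) * (E - Z) + rho * h * Z) by ring.
    apply Rplus_le_compat_r, Rmult_le_compat_l; lra.
  - assert (0 <= P * (D - Z)) by nra.
    assert ((z + rho * h) * (P * (D - Z)) <= (rho * (z + h)) * (P * (D - Z)))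
      by (apply Rmult_le_compat_r; nra).
    assert (rho * h * Z <= P * (rho * h * Z)) by (assert (0 <= rho * h * Z) by nra; nra).
    lra.
Qed.

(** Convexity of [t ^ a] on the nonnegative half-line; it carries the estimate for the bridge left
    of a gap over to the one on its right. *)
Lemma pow_increment_mono (a : nat) (z x h : R) :
  0 <= z <= x -> 0 <= h -> (z + h) ^ a - z ^ a <= (x + h) ^ a - x ^ a.
Proof.
  intros Hz Hh. induction a as [|a IH]; [simpl; lra|].
  pose proof (pow_increment_nonneg a z h (proj1 Hz) Hh) as HD.
  pose proof (pow_incr z x a Hz).
  cbn [pow].
  replace ((z + h) * (z + h) ^ a - z * z ^ a)
    with ((z + h) * ((z + h) ^ a - z ^ a) + h * z ^ a) by ring.
  replace ((x + h) * (x + h) ^ a - x * x ^ a)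
    with ((x + h) * ((x + h) ^ a - x ^ a) + h * x ^ a) by ring.
  apply Rplus_le_compat; nra.
Qed.

Lemma pow_lipschitz (a : nat) (x y : R) :
  0 <= x <= 1 -> 0 <= y <= 1 -> Rabs (x ^ a - y ^ a) <= INR a * Rabs (x - y).
Proof.
  intros Hx Hy. induction a as [|a IH].
  - simpl. rewrite Rminus_diag, Rabs_R0. lra.
  - rewrite S_INR. cbn [pow].
    replace (x * x ^ a - y * y ^ a) with (x * (x ^ a - y ^ a) + (x - y) * y ^ a) by ring.
    eapply Rle_trans; [apply Rabs_triang|]. rewrite !Rabs_mult.
    rewrite (Rabs_right x) by lra.
    assert (0 <= y ^ a <= 1) by (split; [apply pow_le; lra|rewrite <- (pow1 a); apply pow_incr; lra]).
    rewrite (Rabs_right (y ^ a)) by lra.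
    pose proof (Rabs_pos (x ^ a - y ^ a)). pose proof (Rabs_pos (x - y)). nra.
Qed.

Lemma pow_lt_mono (a : nat) (x y : R) : (0 < a)%nat -> 0 <= x < y -> x ^ a < y ^ a.
Proof.
  intros Ha Hxy. destruct a as [|a]; [lia|]. clear Ha. induction a as [|a IH]; [simpl; lra|].
  change (x * x ^ S a < y * y ^ S a).
  pose proof (pow_le x (S a) (proj1 Hxy)). nra.
Qed.

Lemma pow_root_exists (a : nat) (t : R) :
  (0 < a)%nat -> 0 <= t <= 1 -> exists x, 0 <= x <= 1 /\ x ^ a = t.
Proof.
  intros Ha Ht.
  destruct (Req_dec t 0) as [->|Hn]; [exists 0; split; [lra|apply pow_i; lia]|].
  assert (0 < INR a) by (apply lt_0_INR; lia).
  assert (exp (ln t / INR a) ^ a = t) as E.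
  { rewrite <- Rpower_pow by apply exp_pos. unfold Rpower. rewrite ln_exp.
    replace (INR a * (ln t / INR a)) with (ln t) by (field; lra).
    apply exp_ln; lra. }
  exists (exp (ln t / INR a)). split; [|exact E].
  pose proof (exp_pos (ln t / INR a)). split; [lra|].
  apply Rnot_lt_le. intros Hlt.
  pose proof (pow_lt_mono a 1 _ Ha (conj Rle_0_1 Hlt)). rewrite pow1 in *. lra.
Qed.

(** * Basic intervals and their middle gaps *)

Section Cantor.
Variable alpha : R.
Hypothesis alpha_gt1 : 1 < alpha.

Local Notation r := (ratio alpha).
Local Notation rho := ((1 - r) / r).

Lemma ratio_bounds : 0 < r < 1 / 2.
Proof.
  unfold ratio. pose proof (Rinv_0_lt_compat alpha). pose proof (Rinv_1_lt_contravar 1 alpha).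
  rewrite Rinv_1 in *. unfold Rdiv. lra.
Qed.

Lemma rho_gt1 : 1 < rho.
Proof.
  pose proof ratio_bounds. apply Rmult_lt_reg_r with r; [lra|].
  unfold Rdiv. rewrite Rmult_assoc, Rinv_l; lra.
Qed.

(* The pair [(z, d)] stands for the basic interval [[z, z + d]]; level [n]
   lists those of all levels below [n], whose middle gaps are removed in [C_n]. *)
Fixpoint parents (n : nat) : list (R * R) :=
  match n with
  | O => nil
  | S n => (0, 1) :: map (fun p => (f0 alpha (fst p), r * snd p)) (parents n)
                  ++ map (fun p => (f1 alpha (fst p), r * snd p)) (parents n)
  end.

Definition gap_lo (p : R * R) : R := fst p + r * snd p.
Definition gap_hi (p : R * R) : R := fst p + (1 - r) * snd p.

Lemma in_parents_S n p :
  In p (parents (S n)) ->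
  p = (0, 1) \/ exists q, In q (parents n) /\
    (p = (f0 alpha (fst q), r * snd q) \/ p = (f1 alpha (fst q), r * snd q)).
Proof.
  cbn [parents In]. rewrite in_app_iff, !in_map_iff.
  intros [<-|[(q & <- & Hq)|(q & <- & Hq)]]; eauto 6.
Qed.

Lemma parents_bounds n p : In p (parents n) -> 0 <= fst p /\ 0 < snd p /\ fst p + snd p <= 1.
Proof.
  pose proof ratio_bounds as Hr.
  revert p. induction n as [|n IH]; intros p Hp; [destruct Hp|].
  apply in_parents_S in Hp as [->|(q & Hq & [->| ->])];
    [simpl; lra| |]; destruct (IH q Hq) as (A & B & D); simpl; unfold f0, f1; nra.
Qed.

(* Of two nested or disjoint basic intervals, the bridge between their middle
   gaps contains an outer subinterval of one of them. *)
Definition gap_before (p q : R * R) : Prop :=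
  gap_hi p <= gap_lo q /\ (fst p + snd p <= gap_lo q \/ gap_hi p <= fst q).

Lemma gap_before_f0 p q :
  gap_before p q -> gap_before (f0 alpha (fst p), r * snd p) (f0 alpha (fst q), r * snd q).
Proof.
  pose proof ratio_bounds as Hr.
  unfold gap_before, gap_hi, gap_lo, f0; simpl. intros [A B]. split; [nra|].
  destruct B; [left|right]; nra.
Qed.

Lemma gap_before_f1 p q :
  gap_before p q -> gap_before (f1 alpha (fst p), r * snd p) (f1 alpha (fst q), r * snd q).
Proof.
  pose proof ratio_bounds as Hr.
  unfold gap_before, gap_hi, gap_lo, f1; simpl. intros [A B]. split; [nra|].
  destruct B; [left|right]; nra.
Qed.

(** The images under [f0] lie in [[0, r]] and those under [f1] in [[1 - r, 1]], on the two sides of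
    the root gap. Only two intervals in the same copy need the induction hypothesis, which the
    similarity transports. *)
Lemma parents_ordered n p q :
  In p (parents n) -> In q (parents n) -> p = q \/ gap_before p q \/ gap_before q p.
Proof.
  pose proof ratio_bounds as Hr.
  revert p q. induction n as [|n IH]; intros p q Hp Hq; [destruct Hp|].
  apply in_parents_S in Hp as [->|(p' & Hp' & Ep)];
  apply in_parents_S in Hq as [->|(q' & Hq' & Eq)]; [now left| | |].
  - destruct (parents_bounds n q' Hq') as (A & B & D). right.
    destruct Eq as [->| ->]; [right|left]; unfold gap_before, gap_hi, gap_lo, f0, f1; simpl;
      (split; [nra|]); [left|right]; nra.
  - destruct (parents_bounds n p' Hp') as (A & B & D). right.
    destruct Ep as [->| ->]; [left|right]; unfold gap_before, gap_hi, gap_lo, f0, f1; simpl;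
      (split; [nra|]); [left|right]; nra.
  - destruct (parents_bounds n p' Hp') as (A & B & D).
    destruct (parents_bounds n q' Hq') as (A' & B' & D').
    destruct Ep as [->| ->], Eq as [->| ->].
    + destruct (IH p' q' Hp' Hq') as [->|[H|H]]; [now left| |];
        right; [left|right]; now apply gap_before_f0.
    + right; left. unfold gap_before, gap_hi, gap_lo, f0, f1; simpl. split; [nra|right; nra].
    + right; right. unfold gap_before, gap_hi, gap_lo, f0, f1; simpl. split; [nra|right; nra].
    + destruct (IH p' q' Hp' Hq') as [->|[H|H]]; [now left| |];
        right; [left|right]; now apply gap_before_f1.
Qed.

(** Avoiding the root gap puts [t] in [[0, r]] or [[1 - r, 1]]. Undoing [f0] or [f1] there turns the
    gaps of that copy into those of the previous level. *)
Lemma avoid_parents_Cn n t :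
  0 <= t <= 1 -> (forall p, In p (parents n) -> t <= gap_lo p \/ gap_hi p <= t) ->
  Cn alpha n t.
Proof.
  pose proof ratio_bounds as Hr.
  revert t. induction n as [|n IH]; intros t Ht Hg.
  - exists nil. split; [reflexivity|]. exists t. auto.
  - assert (t <= r \/ 1 - r <= t) as [Hlo|Hhi].
    { destruct (Hg (0, 1)) as [H|H]; [now left| |]; unfold gap_lo, gap_hi in H; simpl in H; lra. }
    + assert (t = r * (t / r)) as Et by (field; lra).
      destruct (IH (t / r)) as (w & Hw & x & Hx & E).
      * split; nra.
      * intros p Hp.
        destruct (Hg (f0 alpha (fst p), r * snd p)) as [H|H];
          [right; apply in_app_iff; left; apply in_map_iff; eauto| |];
          unfold gap_lo, gap_hi, f0 in *; simpl in H; [left|right]; nra.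
      * exists (false :: w). split; [simpl; now rewrite Hw|]. exists x. split; [assumption|].
        simpl. unfold f0. now rewrite <- E.
    + assert (t = r * ((t - (1 - r)) / r) + 1 - r) as Et by (field; lra).
      set (u := (t - (1 - r)) / r) in *.
      destruct (IH u) as (w & Hw & x & Hx & E).
      * split; nra.
      * intros p Hp.
        destruct (Hg (f1 alpha (fst p), r * snd p)) as [H|H];
          [right; apply in_app_iff; right; apply in_map_iff; eauto| |];
          unfold gap_lo, gap_hi, f1 in *; simpl in H; [left|right]; nra.
      * exists (true :: w). split; [simpl; now rewrite Hw|]. exists x. split; [assumption|].
        simpl. unfold f1. now rewrite <- E.
Qed.

(** * Thickness of the sets of powers *)

Definition pow_gap (a : nat) (p : R * R) : R * R := (gap_lo p ^ a, gap_hi p ^ a).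
(** For [a > 0] the map [t ^ a] is an increasing bijection of [[0, 1]], so this cell models the set
    of [a]-th powers of points of [C_n]. *)
Definition pow_cell (a n : nat) : cell := Cell 0 1 (map (pow_gap a) (parents n)).

(** [pow_increment_scale] with [h = r * snd p]: the left outer subinterval has length [h], and
    together with the gap it has length [rho * h]. Subtracting the subinterval leaves the factor
    [rho ^ a - 1]. *)
Lemma pow_gap_left (a A : nat) (p : R * R) :
  (a <= A)%nat -> 0 <= fst p -> 0 < snd p ->
  gap_size (pow_gap a p) <= (rho ^ A - 1) * (gap_lo p ^ a - fst p ^ a).
Proof.
  intros HaA Hz Hd. pose proof ratio_bounds as Hr. pose proof rho_gt1 as Hrho.
  unfold gap_size, pow_gap; cbn [fst snd]. unfold gap_lo, gap_hi.
  assert (0 <= r * snd p) as Hh by nra.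
  pose proof (pow_increment_scale a rho (fst p) (r * snd p)) as H.
  replace (rho * (r * snd p)) with ((1 - r) * snd p) in H by (field; lra).
  specialize (H ltac:(lra) Hz Hh).
  pose proof (pow_increment_nonneg a (fst p) (r * snd p) Hz Hh).
  assert (rho ^ a <= rho ^ A) by (apply Rle_pow; [lra|assumption]).
  nra.
Qed.

(** By convexity the right outer subinterval has an image at least as long as that of the left
    one. *)
Lemma pow_gap_right (a A : nat) (p : R * R) :
  (a <= A)%nat -> 0 <= fst p -> 0 < snd p ->
  gap_size (pow_gap a p) <= (rho ^ A - 1) * ((fst p + snd p) ^ a - gap_hi p ^ a).
Proof.
  intros HaA Hz Hd. pose proof ratio_bounds as Hr. pose proof rho_gt1 as Hrho.
  eapply Rle_trans; [apply (pow_gap_left a A); assumption|].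
  apply Rmult_le_compat_l.
  - pose proof (pow_R1_Rle rho A). lra.
  - unfold gap_lo, gap_hi.
    replace (fst p + snd p) with ((fst p + (1 - r) * snd p) + r * snd p) by ring.
    apply pow_increment_mono; nra.
Qed.

(** The bridge contains the image of the right outer subinterval of [p] or of the left one of [q].
    Either one controls the gap of its own interval, hence the minimum. *)
Lemma pow_bridge (a A : nat) (p q : R * R) :
  (a <= A)%nat -> 0 <= fst p -> 0 < snd p -> 0 <= fst q -> 0 < snd q -> gap_before p q ->
  Rmin (gap_size (pow_gap a p)) (gap_size (pow_gap a q))
    <= (rho ^ A - 1) * (fst (pow_gap a q) - snd (pow_gap a p)).
Proof.
  intros HaA Hp Hdp Hq Hdq [_ Hb]. pose proof ratio_bounds as Hr. pose proof rho_gt1 as Hrho.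
  assert (0 <= rho ^ A - 1) as HK by (pose proof (pow_R1_Rle rho A); lra).
  cbn [pow_gap fst snd]. destruct Hb as [Hb|Hb].
  - eapply Rle_trans; [apply Rmin_l|].
    eapply Rle_trans; [apply (pow_gap_right a A); assumption|].
    apply Rmult_le_compat_l; [assumption|].
    pose proof (pow_incr (fst p + snd p) (gap_lo q) a). lra.
  - eapply Rle_trans; [apply Rmin_r|].
    eapply Rle_trans; [apply (pow_gap_left a A); assumption|].
    apply Rmult_le_compat_l; [assumption|].
    assert (0 <= gap_hi p) by (unfold gap_hi; nra).
    pose proof (pow_incr (gap_hi p) (fst q) a). lra.
Qed.

Lemma thick_pow_cell (a A n : nat) :
  (0 < a <= A)%nat -> thick (rho ^ A - 1) (pow_cell a n).
Proof.
  intros [Ha HaA]. pose proof ratio_bounds as Hr. pose proof rho_gt1 as Hrho.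
  assert (0 <= rho ^ A - 1) as HK by (pose proof (pow_R1_Rle rho A); lra).
  split; [|split]; cbn [pow_cell lo hi gaps].
  - lra.
  - intros g Hg. apply in_map_iff in Hg as (p & <- & Hp).
    destruct (parents_bounds n p Hp) as (B1 & B2 & B3). repeat split.
    + cbn [pow_gap fst snd]. apply pow_lt_mono; [assumption|]. unfold gap_lo, gap_hi. nra.
    + eapply Rle_trans; [apply (pow_gap_left a A); assumption|].
      apply Rmult_le_compat_l; [assumption|]. cbn [pow_gap fst snd].
      pose proof (pow_le (fst p) a B1). lra.
    + eapply Rle_trans; [apply (pow_gap_right a A); assumption|].
      apply Rmult_le_compat_l; [assumption|]. cbn [pow_gap fst snd].
      pose proof (pow_incr (fst p + snd p) 1 a). rewrite pow1 in *. lra.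
  - intros g g' Hg Hg'.
    apply in_map_iff in Hg as (p & <- & Hp). apply in_map_iff in Hg' as (q & <- & Hq).
    destruct (parents_bounds n p Hp) as (B1 & B2 & _).
    destruct (parents_bounds n q Hq) as (D1 & D2 & _).
    destruct (parents_ordered n p q Hp Hq) as [->|[H|H]]; [now left|right; left|right; right].
    + apply pow_bridge; assumption.
    + rewrite Rmin_comm. apply pow_bridge; assumption.
Qed.

(** * The Cantor set and its finite-level approximations *)

Lemma fsig_contract b x y : fsig alpha b x - fsig alpha b y = r * (x - y).
Proof. destruct b; simpl; unfold f0, f1; ring. Qed.

Lemma fsig_unit b x : 0 <= x <= 1 -> 0 <= fsig alpha b x <= 1.
Proof. pose proof ratio_bounds. destruct b; simpl; unfold f0, f1; nra. Qed.

Lemma fword_contract w x y : fword alpha w x - fword alpha w y = r ^ length w * (x - y).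
Proof.
  induction w as [|b w IH]; cbn [fword length pow]; [ring|].
  rewrite fsig_contract, IH. ring.
Qed.

Lemma fword_unit w x : 0 <= x <= 1 -> 0 <= fword alpha w x <= 1.
Proof. intros Hx. induction w; [assumption|]. apply fsig_unit; assumption. Qed.

Lemma Cn_unit n x : Cn alpha n x -> 0 <= x <= 1.
Proof. intros (w & _ & t & Ht & ->). now apply fword_unit. Qed.

Lemma Cn_S n x : Cn alpha (S n) x <-> exists b y, Cn alpha n y /\ x = fsig alpha b y.
Proof.
  split.
  - intros ([|b w] & Hw & t & Ht & ->); [discriminate|]. injection Hw as Hw.
    exists b, (fword alpha w t). split; [|reflexivity]. exists w. eauto.
  - intros (b & y & (w & Hw & t & Ht & ->) & ->). exists (b :: w).
    split; [simpl; now rewrite Hw|]. eauto.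
Qed.

Lemma Calpha_unit x : Calpha alpha x -> 0 <= x <= 1.
Proof. intros H. apply (Cn_unit 1), H. lia. Qed.

Lemma Calpha_fixed b x : 0 <= x <= 1 -> fsig alpha b x = x -> Calpha alpha x.
Proof.
  intros Hx Hf n _. induction n as [|n IH].
  - exists nil. split; [reflexivity|]. eauto.
  - apply Cn_S. eauto.
Qed.

Lemma Calpha_0 : Calpha alpha 0.
Proof. apply (Calpha_fixed false); [lra|]. simpl. unfold f0. ring. Qed.

Lemma Calpha_1 : Calpha alpha 1.
Proof. apply (Calpha_fixed true); [lra|]. simpl. unfold f1. ring. Qed.

Lemma Calpha_fword w x : Calpha alpha x -> Calpha alpha (fword alpha w x).
Proof.
  intros Hx. induction w as [|b w IH]; [assumption|]. intros [|n] Hn; [lia|].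
  apply Cn_S. exists b, (fword alpha w x). split; [|reflexivity].
  (* [Calpha] speaks of levels from 1 on only, so level 0 is supplied by the bounds of the unit
     interval. *)
  destruct n as [|n]; [|apply IH; lia].
  exists nil. split; [reflexivity|]. exists (fword alpha w x).
  split; [apply Calpha_unit, IH|reflexivity].
Qed.

(** The left endpoint [fword alpha w 0] of the basic interval containing [x] is in the Cantor set,
    and this interval has length [r ^ n]. *)
Lemma Cn_near_Calpha n x : Cn alpha n x -> exists c, Calpha alpha c /\ Rabs (x - c) <= r ^ n.
Proof.
  pose proof ratio_bounds as Hr.
  intros (w & <- & t & Ht & ->). exists (fword alpha w 0).
  split; [apply Calpha_fword, Calpha_0|].
  rewrite fword_contract, Rabs_mult, Rminus_0_r, !Rabs_right; [| lra|].
  - pose proof (pow_le r (length w)). nra.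
  - apply Rle_ge, pow_le. lra.
Qed.


(** * Closedness and compactness *)

Definition adherent (S : R -> Prop) (y : R) : Prop :=
  forall eps, 0 < eps -> exists s, S s /\ Rabs (s - y) < eps.

Lemma not_adherent (S : R -> Prop) y :
  ~ adherent S y -> exists eps, 0 < eps /\ forall s, S s -> eps <= Rabs (s - y).
Proof.
  intros H. apply not_all_ex_not in H as [eps H]. apply imply_to_and in H as [He H].
  exists eps. split; [assumption|]. intros s Hs. apply Rnot_lt_le. intros Hlt. apply H. eauto.
Qed.

Lemma Cn_closed n x : adherent (Cn alpha n) x -> Cn alpha n x.
Proof.
  pose proof ratio_bounds as Hr.
  revert x. induction n as [|n IH]; intros x Hx.
  - exists nil. split; [reflexivity|]. exists x. split; [|reflexivity].
    split; apply Rnot_lt_le; intros Hlt.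
    + destruct (Hx (- x)) as (s & Hs & H); [lra|]. apply Cn_unit in Hs.
      apply Rabs_def2 in H. lra.
    + destruct (Hx (x - 1)) as (s & Hs & H); [lra|]. apply Cn_unit in Hs.
      apply Rabs_def2 in H. lra.
  - apply Cn_S.
    set (pre := fun b => (x - fsig alpha b 0) / r).
    assert (forall b, x = fsig alpha b (pre b)) as Hpre.
    { intros b. unfold pre. destruct b; simpl; unfold f0, f1; field; lra. }
    (* If neither preimage of [x] were adherent to level [n], with distances at least [e0] and [e1],
       then level [n + 1] would stay at distance [r * Rmin e0 e1] from [x]. *)
    destruct (classic (exists b, adherent (Cn alpha n) (pre b))) as [[b Hb]|Hn]; [eauto|].
    exfalso.
    destruct (not_adherent (Cn alpha n) (pre false)) as (e0 & P0 & H0); [eauto|].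
    destruct (not_adherent (Cn alpha n) (pre true)) as (e1 & P1 & H1); [eauto|].
    destruct (Hx (r * Rmin e0 e1)) as (s & Hs & H).
    { apply Rmult_lt_0_compat; [lra|]. now apply Rmin_glb_lt. }
    apply Cn_S in Hs as (b & y & Hy & ->).
    rewrite (Hpre b), fsig_contract, Rabs_mult, (Rabs_right r) in H by lra.
    apply Rmult_lt_reg_l in H; [|lra].
    pose proof (Rmin_l e0 e1). pose proof (Rmin_r e0 e1).
    destruct b; [specialize (H1 y Hy)|specialize (H0 y Hy)]; lra.
Qed.

(** Bolzano-Weierstrass on [[0, 1]] gives the cluster point, and closedness of every [C_n] puts it
    in the Cantor set. *)
Lemma Calpha_cluster (u : nat -> R) :
  (forall n, Calpha alpha (u n)) ->
  exists l, Calpha alpha l /\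
    forall eps N, 0 < eps -> exists n, (N <= n)%nat /\ Rabs (u n - l) < eps.
Proof.
  intros Hu.
  destruct (Bolzano_Weierstrass u (fun c => 0 <= c <= 1) (compact_P3 0 1)) as [l Hl].
  { intros n. apply Calpha_unit, Hu. }
  assert (forall eps N, 0 < eps -> exists n, (N <= n)%nat /\ Rabs (u n - l) < eps) as Hcl.
  { intros eps N He. destruct (Hl (disc l (mkposreal eps He)) N) as (n & Hn & Hd).
    - exists (mkposreal eps He). intros t Ht. exact Ht.
    - exists n. split; [assumption|exact Hd]. }
  exists l. split; [|assumption].
  intros n Hn. apply Cn_closed. intros eps He.
  destruct (Hcl eps 0%nat He) as (k & _ & Hk). exists (u k). split; [now apply Hu|assumption].
Qed.

(** * Sums of powers of Cantor points *)

(** Splitting off one summand at a time lets closedness be proved by induction, with a limit in a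
    single variable at each step. *)
Fixpoint pow_sum (es : list nat) (y : R) : Prop :=
  match es with
  | nil => y = 0
  | e :: es => exists x, Calpha alpha x /\ pow_sum es (y - x ^ e)
  end.

(** Take sums converging to [y] and a cluster point [l] of their first variables: then [y - l ^ e]
    is adherent to the sums of the remaining powers. *)
Lemma pow_sum_closed es y : adherent (pow_sum es) y -> pow_sum es y.
Proof.
  revert y. induction es as [|e es IH]; intros y Hy.
  - simpl. apply NNPP. intros Hn.
    destruct (Hy (Rabs y)) as (s & Hs & H); [now apply Rabs_pos_lt|].
    simpl in Hs. subst s. rewrite Rminus_0_l, Rabs_Ropp in H. lra.
  - assert (forall n, exists x, Calpha alpha x /\
              exists s, pow_sum es s /\ Rabs (s + x ^ e - y) < / INR (S n)) as Hseq.
    { intros n. destruct (Hy (/ INR (S n))) as (s & (x & Hx & Hs) & H).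
      - apply Rinv_0_lt_compat, lt_0_INR. lia.
      - exists x. split; [assumption|]. exists (s - x ^ e). split; [assumption|].
        now replace (s - x ^ e + x ^ e - y) with (s - y) by ring. }
    apply functional_choice in Hseq as [u Hu].
    destruct (Calpha_cluster u) as (l & Hl & Hcl); [intros n; apply Hu|].
    exists l. split; [assumption|]. apply IH. intros eps He.
    (* Half of [eps] pays for the Lipschitz error [INR e * d], half for the error of the
       approximating sum; the [+ 1] covers [e = 0]. *)
    set (d := eps / 2 / (INR e + 1)).
    pose proof (pos_INR e) as HINR.
    assert (0 < d) as Hd by (apply Rdiv_lt_0_compat; lra).
    destruct (archimed_cor1 (eps / 2)) as (N & HN & HN0); [lra|].
    destruct (Hcl d N Hd) as (n & Hn & Hun).
    destruct (Hu n) as (Hcn & s & Hs & Hsn).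
    exists s. split; [assumption|].
    replace (s - (y - l ^ e)) with ((s + u n ^ e - y) + (l ^ e - u n ^ e)) by ring.
    eapply Rle_lt_trans; [apply Rabs_triang|].
    pose proof (pow_lipschitz e l (u n) (Calpha_unit l Hl) (Calpha_unit (u n) Hcn)) as HL.
    rewrite (Rabs_minus_sym l (u n)) in HL.
    assert (/ INR (S n) <= / INR N).
    { apply Rinv_le_contravar; [now apply lt_0_INR|apply le_INR; lia]. }
    assert ((INR e + 1) * d = eps / 2) by (unfold d; field; lra).
    pose proof (Rabs_pos (u n - l)). nra.
Qed.

(** The [e]-th root of a surviving point avoids all gaps of level [n], so it lies in [C_n]. Moving
    it to the Cantor set costs at most [r ^ n], hence at most [A * r ^ n] in its power. *)
Lemma pow_sum_near (A n : nat) es ts :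
  (forall e, In e es -> (0 < e <= A)%nat) ->
  Forall2 survives (map (fun e => pow_cell e n) es) ts ->
  exists s, pow_sum es s /\ Rabs (s - Rsum ts) <= INR (length es) * (INR A * r ^ n).
Proof.
  pose proof ratio_bounds as Hr.
  revert ts. induction es as [|e es IH]; intros ts He Hts.
  - inversion Hts; subst. exists 0. split; [reflexivity|].
    simpl. rewrite Rminus_diag, Rabs_R0. lra.
  - cbn [map] in Hts. inversion Hts as [|? t ? ts' [Ht Hg] Hts']; subst. cbn [pow_cell lo hi gaps] in *.
    destruct (He e (or_introl eq_refl)) as [He0 HeA].
    destruct (IH ts') as (s & Hs & Hsd); [intros; apply He; now right|assumption|].
    destruct (pow_root_exists e t He0 Ht) as (x & Hx & <-).
    assert (Cn alpha n x) as Hxn.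
    { apply avoid_parents_Cn; [assumption|]. intros p Hp.
      destruct (parents_bounds n p Hp) as (B1 & B2 & _).
      assert (0 <= gap_lo p /\ 0 <= gap_hi p) as [L0 H0] by (unfold gap_lo, gap_hi; nra).
      destruct (Hg (pow_gap e p)) as [H|H]; [apply in_map; assumption|left|right];
        apply Rnot_lt_le; intros Hlt; cbn [pow_gap fst snd] in H.
      - pose proof (pow_lt_mono e (gap_lo p) x He0 (conj L0 Hlt)). lra.
      - pose proof (pow_lt_mono e x (gap_hi p) He0 (conj (proj1 Hx) Hlt)). lra. }
    destruct (Cn_near_Calpha n x Hxn) as (c & Hc & Hxc).
    exists (s + c ^ e). split.
    + exists c. split; [assumption|]. now replace (s + c ^ e - c ^ e) with s by ring.
    + cbn [Rsum fold_right length]. fold (Rsum ts'). rewrite S_INR.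
      replace (s + c ^ e - (x ^ e + Rsum ts')) with ((s - Rsum ts') + (c ^ e - x ^ e)) by ring.
      eapply Rle_trans; [apply Rabs_triang|].
      pose proof (pow_lipschitz e c x (Calpha_unit c Hc) Hx) as HL.
      rewrite (Rabs_minus_sym c x) in HL.
      assert (INR e * Rabs (x - c) <= INR A * r ^ n).
      { apply Rmult_le_compat; [apply pos_INR|apply Rabs_pos|now apply le_INR|assumption]. }
      lra.
Qed.

(** At each level [thick_sum] hits [y] exactly; [pow_sum_near] replaces this by true sums with error
    tending to 0, and closedness finishes. *)
Lemma pow_sum_interval (A : nat) es y :
  (0 < A)%nat -> (forall e, In e es -> (0 < e <= A)%nat) ->
  rho ^ A <= INR (length es) -> 0 <= y <= INR (length es) -> pow_sum es y.
Proof.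
  intros HA He Hm Hy. pose proof ratio_bounds as Hr. pose proof rho_gt1 as Hrho.
  apply pow_sum_closed. intros eps Heps.
  set (M := INR (length es) * INR A).
  assert (0 <= M) by (apply Rmult_le_pos; apply pos_INR).
  destruct (pow_lt_1_zero r ltac:(rewrite Rabs_right; lra) (eps / (M + 1))) as (n & Hn);
    [apply Rdiv_lt_0_compat; lra|].
  specialize (Hn n (le_n n)). rewrite Rabs_right in Hn by (apply Rle_ge, pow_le; lra).
  assert (1 < rho ^ A) by (apply Rlt_pow_R1; assumption).
  assert (forall l : list nat, Rsum (map lo (map (fun e => pow_cell e n) l)) = 0) as Hlo.
  { intros l. induction l as [|e l IHl]; simpl; [reflexivity|]. unfold Rsum in *. lra. }
  assert (forall l : list nat,
    Rsum (map hi (map (fun e => pow_cell e n) l)) = INR (length l)) as Hhi.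
  { intros l. induction l as [|e l IHl]; [reflexivity|].
    cbn [length map Rsum fold_right]. rewrite S_INR. unfold Rsum in *. rewrite IHl. simpl. ring. }
  destruct (thick_sum (rho ^ A - 1) (map (fun e => pow_cell e n) es) y) as (ts & Hts & Hs).
  - lra.
  - rewrite length_map. lra.
  - intros c Hc. apply in_map_iff in Hc as (e & <- & Hin). apply thick_pow_cell; auto.
  - intros c d g Hc Hd Hg.
    apply in_map_iff in Hc as (e & <- & Hin). apply in_map_iff in Hd as (e' & <- & _).
    destruct (thick_pow_cell e A n (He e Hin)) as (_ & HT & _).
    destruct (HT g Hg) as (Hlt & H1 & H2). unfold gap_size in *. cbn [pow_cell lo hi] in *. nra.
  - rewrite Hlo, Hhi. assumption.
  - destruct (pow_sum_near A n es ts He Hts) as (s & Hps & Hd).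
    exists s. split; [assumption|]. rewrite Hs in Hd.
    eapply Rle_lt_trans; [exact Hd|].
    rewrite <- Rmult_assoc. fold M.
    assert ((M + 1) * (eps / (M + 1)) = eps) by (field; lra).
    assert (0 <= r ^ n) by (apply pow_le; lra). nra.
Qed.

Lemma pow_sum_seq (e : nat -> nat) (m st : nat) (y : R) :
  pow_sum (map e (seq st m)) y ->
  exists x : nat -> R, (forall i, Calpha alpha (x i)) /\
    y = Rsum (map (fun i => x i ^ e i) (seq st m)).
Proof.
  revert st y. induction m as [|m IH]; intros st y H; simpl in H.
  - exists (fun _ => 0). split; [intros; apply Calpha_0|exact H].
  - destruct H as (x0 & Hx0 & H). apply IH in H as (x & Hx & H).
    exists (fun i => if Nat.eq_dec i st then x0 else x i). split.
    + intros i. destruct (Nat.eq_dec i st); auto.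
    + cbn [seq map Rsum fold_right]. destruct (Nat.eq_dec st st); [|congruence].
      apply (Rplus_eq_reg_r (- x0 ^ e st)).
      replace (y + - x0 ^ e st) with (y - x0 ^ e st) by ring. rewrite H.
      unfold Rsum. ring_simplify. f_equal. apply map_ext_in.
      intros i Hi. apply in_seq in Hi. destruct (Nat.eq_dec i st); [lia|reflexivity].
Qed.

End Cantor.

(** * Reduction of the theorem to one variable per pair *)

(** The second bound shows that two exponents with sum [s] cannot both exceed [abar s]. *)
Lemma abar_spec s : (2 <= s)%nat -> (1 <= abar s)%nat /\ (s <= 2 * abar s + 1)%nat.
Proof.
  intros Hs. unfold abar. destruct (Nat.odd s) eqn:E.
  - apply Nat.odd_spec in E as [j ->].
    replace (2 * j + 1 - 1)%nat with (j * 2)%nat by lia. rewrite Nat.div_mul; lia.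
  - assert (Nat.even s = true) as E' by (rewrite <- Nat.negb_odd, E; reflexivity).
    apply Nat.even_spec in E' as [j ->].
    rewrite Nat.mul_comm, Nat.div_mul; lia.
Qed.

Lemma sum1_bounds (m : nat) (F : nat -> R) :
  (forall i, (1 <= i <= m)%nat -> 0 <= F i <= 1) -> 0 <= sum1 m F <= INR m.
Proof.
  intros HF. unfold sum1.
  assert (forall l, (forall i, In i l -> 0 <= F i <= 1) ->
    0 <= fold_right Rplus 0 (map F l) <= INR (length l)) as H.
  { induction l as [|i l IH]; intros Hl; [simpl; lra|].
    cbn [length map fold_right]. rewrite S_INR.
    assert (0 <= F i <= 1) by (apply Hl; now left).
    assert (0 <= fold_right Rplus 0 (map F l) <= INR (length l))
      by (apply IH; intros; apply Hl; now right).
    lra. }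
  specialize (H (seq 1 m)). rewrite length_seq in H. apply H.
  intros i Hi. apply in_seq in Hi. apply HF. lia.
Qed.

Theorem mainTheorem4 (alpha : R) (s k : nat) (a : nat -> nat) :
  1 < alpha -> (2 <= s)%nat ->
  (0 < k)%nat -> Nat.Even k ->
  (forall i, (1 <= i <= k)%nat -> (0 < a i)%nat) ->
  (forall i, (1 <= i <= k / 2)%nat -> (a (2 * i - 1) + a (2 * i) = s)%nat) ->
  INR k >= kbound alpha s ->
  forall y : R,
    (0 <= y <= INR k / 2) <->
    (exists x : nat -> R,
        (forall i, (1 <= i <= k)%nat -> Calpha alpha (x i)) /\
        y = sum1 (k / 2) (fun i => x (2 * i - 1)%nat ^ a (2 * i - 1)%nat
                                   * x (2 * i)%nat ^ a (2 * i)%nat)).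
Proof.
  intros Halpha Hs Hk Heven Ha Hpair Hbound y.
  destruct Heven as [m ->].
  assert ((2 * m / 2)%nat = m) as Hdiv by (rewrite Nat.mul_comm; apply Nat.div_mul; lia).
  rewrite Hdiv in *.
  assert (INR (2 * m) = 2 * INR m) as HINR by (rewrite mult_INR; reflexivity).
  rewrite HINR in *. replace (2 * INR m / 2) with (INR m) by field.
  split.
  - intros Hy.
    destruct (abar_spec s Hs) as [Hab Hs'].
    pose proof (rho_gt1 alpha Halpha) as Hrho.
    (* [low i] records whether the first variable of pair [i] is the one kept; otherwise the second
       exponent is at most [abar s]. The kept exponent is [e i]. *)
    set (low := fun i => (a (2 * i - 1) <=? abar s)%nat).
    set (e := fun i => if low i then a (2 * i - 1)%nat else a (2 * i)%nat).
    (* The second term of the maximum gives [rho ^ (abar s + 1) <= m], and [rho > 1]. *)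
    assert (((1 - ratio alpha) / ratio alpha) ^ abar s <= INR m) as Hm.
    { unfold kbound in Hbound; cbv zeta in Hbound.
      match type of Hbound with _ >= Rmax (Rmax ?p ?q) ?t =>
        pose proof (Rmax_l (Rmax p q) t); pose proof (Rmax_r p q) end.
      assert (((1 - ratio alpha) / ratio alpha) ^ abar s
              <= ((1 - ratio alpha) / ratio alpha) ^ (abar s + 1))
        by (apply Rle_pow; [lra|lia]).
      lra. }
    assert (forall i, In i (seq 1 m) -> (0 < e i <= abar s)%nat) as He.
    { intros i Hi. apply in_seq in Hi. unfold e, low.
      specialize (Hpair i ltac:(lia)).
      pose proof (Ha (2 * i)%nat ltac:(lia)). pose proof (Ha (2 * i - 1)%nat ltac:(lia)).
      destruct (Nat.leb_spec (a (2 * i - 1)%nat) (abar s)); lia. }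
    assert (pow_sum alpha (map e (seq 1 m)) y) as Hsum.
    { apply (pow_sum_interval alpha Halpha (abar s)); rewrite ?length_map, ?length_seq; auto.
      intros j Hj. apply in_map_iff in Hj as (i & <- & Hi). auto. }
    apply pow_sum_seq in Hsum as (x & Hx & ->).
    (* Index [j] belongs to pair [(j + 1) / 2] and is its first member when odd. The kept variable
       takes the Cantor value, its partner takes 1. *)
    exists (fun j => let i := ((j + 1) / 2)%nat in
                     if Bool.eqb (Nat.odd j) (low i) then x i else 1).
    split.
    + intros j _. cbv zeta. destruct (Bool.eqb _ _); [apply Hx|apply Calpha_1].
    + unfold sum1, Rsum. f_equal. apply map_ext_in. intros i Hi. apply in_seq in Hi.
      replace ((2 * i - 1 + 1) / 2)%nat with i
        by (replace (2 * i - 1 + 1)%nat with (i * 2)%nat by lia; now rewrite Nat.div_mul).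
      replace ((2 * i + 1) / 2)%nat with i
        by (apply Nat.div_unique with 1%nat; lia).
      replace (Nat.odd (2 * i - 1)) with true
        by (symmetry; apply Nat.odd_spec; exists (i - 1)%nat; lia).
      replace (Nat.odd (2 * i)) with false
        by (symmetry; rewrite <- Nat.negb_even, Nat.even_mul; reflexivity).
      unfold e. destruct (low i); simpl Bool.eqb; cbv iota; rewrite pow1; ring.
  (* Conversely, Cantor points lie in [[0, 1]], hence so does each of the [m] products. *)
  - intros (x & Hx & ->). apply sum1_bounds. intros i Hi.
    assert (forall j, (1 <= j <= 2 * m)%nat -> 0 <= x j ^ a j <= 1) as Hp.
    { intros j Hj. pose proof (Calpha_unit alpha Halpha (x j) (Hx j Hj)) as Hu.
      split; [apply pow_le; lra|]. rewrite <- (pow1 (a j)). apply pow_incr. lra. }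
    pose proof (Hp (2 * i - 1)%nat ltac:(lia)). pose proof (Hp (2 * i)%nat ltac:(lia)). nra.
Qed.
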